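(* Let $\epsilon < 1/2$. There is no algorithm with the following property: for every weighted undirected graph $G$ (with labeled vertices), given the transcripts of $m$ random walks of length $T$ in $G$, each started at an independent uniformly random vertex, the algorithm outputs a distribution $q$ on $\mathbb R$ with $W_1(p_G, q) \le \epsilon$ with probability greater than $3/4$ — unless $m\cdot T > \frac{1}{16}\cdot 2^{1/(4\epsilon)}$. Here $p_G$ is the spectral density of $G$.
   Context: For a weighted undirected graph $G$ on $N$ vertices (nonnegative edge weights, self-loops allowed), let $\tilde A$ be its weighted adjacency matrix, $D$ the diagonal matrix of row sums of $\tilde A$, and $A(G)=D^{-1/2}\tilde A D^{-1/2}$ its normalized adjacency matrix with eigenvalues $\lambda_1,\dots,\lambda_N\in[-1,1]$. The spectral density of $G$ is $p_G=\frac1N\sum_{i}\delta_{\lambda_i}$. A random walk in $G$ moves from vertex $v$ to $v'$ with probability $\tilde A(v,v')/D(v,v)$ (the $(v,v')$ entry of $D^{-1}\tilde A$). The transcript of a walk is the sequence of vertex labels it visits, in order. $W_1$ denotes the Wasserstein-1 distance: the minimum over couplings $\psi$ of the two distributions of $\int\int|x-y|\,d\psi(x,y)$. *)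

(* Defs.v *)
From HB Require Import structures.
From mathcomp Require Import all_boot all_order all_algebra.
From mathcomp Require Import sesquilinear spectral complex.
From mathcomp Require Import all_classical all_reals all_analysis.

Set Implicit Arguments.
Unset Strict Implicit.
Unset Printing Implicit Defensive.

Import Order.TTheory GRing.Theory Num.Theory.
Local Open Scope classical_set_scope.
Local Open Scope ring_scope.

(* Vertices are labelled 0, ..., order - 1.  Every vertex has positive degree,
   so that D^{-1/2} and D^{-1} make sense. *)
Record wgraph (R : realType) := WGraph {
  order : nat ;
  order_gt0 : (0 < order)%N ;
  adj : 'M[R]_order ;
  adj_sym : forall u v, adj u v = adj v u ;
  adj_ge0 : forall u v, 0 <= adj u v ;
  adj_rowsum_gt0 : forall v, 0 < \sum_u adj v u
}.

Section Spectrum.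
Context {R : realType}.
Implicit Type G : wgraph R.

Definition degree G (v : 'I_(order G)) : R := \sum_u adj G v u.

Definition normalized_adj G : 'M[R]_(order G) :=
  let Dm12 := diag_mx (\row_v (Num.sqrt (degree v))^-1) in
  Dm12 *m adj G *m Dm12.

Lemma normalized_adj_sym G : (normalized_adj G)^T = normalized_adj G.
Proof.
rewrite /normalized_adj !trmx_mul tr_diag_mx mulmxA.
by congr (_ *m _ *m _); apply/matrixP => u v; rewrite mxE adj_sym.
Qed.

Lemma char_poly_conj (F : fieldType) (n : nat) (P A : 'M[F]_n) :
  P \in unitmx -> char_poly (invmx P *m A *m P) = char_poly A.
Proof.
move=> Pu; rewrite /char_poly /char_poly_mx !map_mxM.
have PVP : map_mx polyC (invmx P) *m map_mx polyC P = 1%:M.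
  by rewrite -map_mxM mulVmx// map_mx1.
have -> : 'X%:M - map_mx polyC (invmx P) *m map_mx polyC A *m map_mx polyC P =
    map_mx polyC (invmx P) *m ('X%:M - map_mx polyC A) *m map_mx polyC P.
  by rewrite mulmxBr mulmxBl scalar_mxC -(mulmxA _%:M) PVP mulmx1.
by rewrite !det_mulmx mulrAC -det_mulmx PVP det1 mul1r.
Qed.

Lemma sym_char_poly_split (n : nat) (A : 'M[R]_n) : A^T = A ->
  exists lam : n.-tuple R, char_poly A = \prod_(x <- lam) ('X - x%:P).
Proof.
move=> Asym; pose toC : {rmorphism R -> R[i]} := real_complex R.
pose B := map_mx toC A.
have Bh : B \is hermsymmx.
  apply: realsym_hermsym.
    by apply/is_hermitianmxP; rewrite expr0 scale1r map_mx_id // /B map_trmx Asym.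
  by apply/mxOverP => i j; rewrite mxE; apply/Creal_ImP; rewrite -complexIm.
have /orthomx_spectralP BE : B \is normalmx by exact: hermitian_normalmx.
have /mxOverP dreal := hermitian_spectral_diag_real Bh.
exists [tuple complex.Re (spectral_diag B 0 i) | i < n].
apply: (map_poly_inj toC); rewrite map_char_poly -/B [in LHS]BE.
rewrite char_poly_conj ?spectral_unit// char_poly_trig; last first.
  exact/is_diag_mx_is_trig/diag_mx_is_diag.
rewrite big_map big_enum/= rmorph_prod/=; apply: eq_bigr => i _.
by rewrite mxE eqxx mulr1n rmorphB/= map_polyX map_polyC/= RRe_real.
Qed.

Definition eigenvalues G : (order G).-tuple R :=
  sval (cid (sym_char_poly_split (normalized_adj_sym G))).

Lemma char_poly_eigenvalues G :
  char_poly (normalized_adj G) = \prod_(x <- eigenvalues G) ('X - x%:P).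
Proof. exact: svalP (cid (sym_char_poly_split (normalized_adj_sym G))). Qed.

Definition spectral_density G (B : set (measurableTypeR R)) : \bar R :=
  (((order G)%:R^-1)%:E * \sum_(i < order G) \d_(tnth (eigenvalues G) i) B)%E.

Section spectral_density_probability.
Variable G : wgraph R.
Local Notation p := (spectral_density G).

Let p0 : p set0 = 0%E.
Proof. by rewrite /spectral_density big1 ?mule0 // => i _; rewrite measure0. Qed.

Let p_ge0 B : (0 <= p B)%E.
Proof. by rewrite mule_ge0 ?lee_fin ?invr_ge0 ?sume_ge0. Qed.

Let p_sigma_additive : semi_sigma_additive p.
Proof.
have invN_ge0 : 0 <= (order G)%:R^-1 :> R by rewrite invr_ge0.
pose q : {measure set (measurableTypeR R) -> \bar R} :=
  mscale (NngNum invN_ge0)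
    (msum (fun k => \d_((eigenvalues G)`_k : measurableTypeR R)) (order G)).
have -> : p = q.
  apply/funext => B; rewrite /q/= /mscale /msum /spectral_density/=.
  by congr (_ * _)%E; apply: eq_bigr => i _; rewrite (tnth_nth 0).
exact: measure_semi_sigma_additive.
Qed.

HB.instance Definition _ :=
  isMeasure.Build _ _ _ p p0 p_ge0 p_sigma_additive.

Let p_setT : p setT = 1%E.
Proof.
rewrite /spectral_density (eq_bigr (fun=> 1%:E)); last first.
  by move=> i _; rewrite diracT.
rewrite sumEFin sumr_const card_ord -EFinM mulVf// pnatr_eq0.
by rewrite -lt0n order_gt0.
Qed.

HB.instance Definition _ := Measure_isProbability.Build _ _ _ p p_setT.
End spectral_density_probability.

End Spectrum.

Section Wasserstein.
Context {R : realType}.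
Local Notation RB := (measurableTypeR R).
Local Open Scope ereal_scope.

Definition coupling (p q : probability RB R) : set (probability (RB * RB)%type R) :=
  [set psi | (forall B : set RB, measurable B -> psi (B `*` setT) = p B) /\
             (forall B : set RB, measurable B -> psi (setT `*` B) = q B)].

Definition W1 (p q : probability RB R) : \bar R :=
  ereal_inf [set \int[psi]_z (`|z.1 - z.2|%R)%:E | psi in coupling p q].

End Wasserstein.

Section Walks.
Context {R : realType}.
Implicit Type G : wgraph R.

Definition transition_mx G : 'M[R]_(order G) :=
  diag_mx (\row_v (degree v)^-1) *m adj G.

(* A walk of length T makes T steps, hence visits T + 1 vertices. *)
Definition walk_prob G (T : nat) (w : T.+1.-tuple 'I_(order G)) : R :=
  (order G)%:R^-1 *
  \prod_(t < T) transition_mx G (tnth w (widen_ord (leqnSn T) t))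
                                (tnth w (lift ord0 t)).

Definition walks_prob G (m T : nat) (W : m.-tuple (T.+1.-tuple 'I_(order G))) : R :=
  \prod_(i < m) walk_prob (tnth W i).

Definition transcripts G (m T : nat) (W : m.-tuple (T.+1.-tuple 'I_(order G))) :
    m.-tuple (T.+1.-tuple nat) :=
  map_tuple (map_tuple (@nat_of_ord (order G))) W.

End Walks.

(* A randomized algorithm: internal randomness drawn from an arbitrary
   probability space, independently of the input, and no restriction on the
   computational resources. *)
Record algorithm (R : realType) (input output : Type) := Algorithm {
  seed_display : measure_display ;
  seed : measurableType seed_display ;
  seed_law : probability seed R ;
  run : seed -> input -> output
}.

(* Inner measure: it agrees with P on events, and spares any measurability
   assumption on the algorithm. *)
Definition inner_prob (R : realType) (d : measure_display) (O : measurableType d)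
    (P : probability O R) (E : set O) : \bar R :=
  ereal_sup [set P B | B in [set B | measurable B /\ B `<=` E]].

(* Probability, over the m walks and the independent internal randomness, that
   the output is within eps of the spectral density; the finitely many possible
   outcomes of the walks are summed over. *)
Definition success_prob (R : realType) (m T : nat)
    (A : algorithm R (m.-tuple (T.+1.-tuple nat))
           (probability (measurableTypeR R) R))
    (eps : R) (G : wgraph R) : \bar R :=
  (\sum_(W : m.-tuple (T.+1.-tuple 'I_(order G)))
     (walks_prob W)%:E *
     inner_prob (seed_law A)
       [set s | W1 (spectral_density G) (run s (transcripts W)) <= eps%:E])%E.

(* Main.v *)
Require Import Defs.
From mathcomp Require Import all_boot all_order all_algebra.
From mathcomp Require Import all_classical all_reals all_analysis.
From mathcomp Require Import measurable_realfun ring lra.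

(** Let [n = k.+1] be the largest integer below [1 / (2 * eps)]. The hypercube on
    F_2^n has the eigenvalues [1 - 2 j / n] with binomial multiplicities; two copies
    of its quotient by the antipodal map have only those with [j] even, each
    counted twice. The 1-Lipschitz distance to the even levels therefore
    separates the two spectral densities by [1 / n > 2 * eps] in W1.
    Both graphs are Cayley graphs of F_2^n, for the generators [e_i] and [fold e_i]
    where [fold x = x + x_0 * (1, ..., 1)], so their walks are driven by the same
    random choices and agree modulo the antipodal map. If the two labels in every
    antipodal pair are exchanged at random, the transcripts of the two graphs
    have the same law unless two visited vertices are antipodal, and each pair of
    times has probability at most [2 / 2 ^ n] of producing this. *)

Set Implicit Arguments.
Unset Strict Implicit.
Unset Printing Implicit Defensive.

Import Order.TTheory GRing.Theory Num.Theory.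
Local Open Scope ring_scope.

(** * Vectors of F_2^n and the antipodal quotient *)

Section Cube.
Context {k : nat}.
Local Notation V := {ffun 'I_k.+1 -> bool}.
Implicit Types x y v : V.

Definition unitv (i : 'I_k.+1) : V := [ffun j => j == i].
Definition constv (b : bool) : V := [ffun=> b].
(** The linear projection onto x_0 = 0 along the all-ones vector: two points have the same image
    exactly when they are equal or antipodal. *)
Definition fold x : V := x + constv (x ord0).
Definition foldedv (i : 'I_k.+1) : V := fold (unitv i).

Lemma addcc x : x + x = 0.
Proof. by apply/ffunP => i; rewrite !ffunE; case: (x i). Qed.

Lemma oppc x : - x = x.
Proof. by apply/esym/eqP; rewrite -addr_eq0 addcc. Qed.

Lemma constvD a b : constv (a + b) = constv a + constv b.
Proof. by apply/ffunP => i; rewrite !ffunE. Qed.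

Lemma constv0 : constv false = 0.
Proof. by apply/ffunP => i; rewrite !ffunE. Qed.

Lemma foldD x y : fold (x + y) = fold x + fold y.
Proof. by rewrite /fold addrACA -constvD ffunE. Qed.

Lemma fold0 : fold 0 = 0.
Proof. by rewrite /fold ffunE constv0 addr0. Qed.

Lemma fold_constv b : fold (constv b) = 0.
Proof. by rewrite /fold ffunE addcc. Qed.

Lemma fold_sum (I : finType) (P : pred I) (F : I -> V) :
  fold (\sum_(i | P i) F i) = \sum_(i | P i) fold (F i).
Proof. exact: (big_morph _ foldD fold0). Qed.

Lemma fold_eq0 x : fold x = 0 -> x = constv (x ord0).
Proof. by move/eqP; rewrite addr_eq0 oppc => /eqP. Qed.

Lemma card_cube : #|{: V}| = (2 ^ k.+1)%N.
Proof. by rewrite card_ffun card_bool card_ord. Qed.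

(** * Walsh characters and path counts in the hypercube *)

Context {R : numDomainType}.

Definition chi (a x : V) : R := \prod_i (-1) ^+ (a i && x i).

Lemma chiC a x : chi a x = chi x a.
Proof. by apply: eq_bigr => i _; rewrite andbC. Qed.

Lemma chiD a x y : chi a (x + y) = chi a x * chi a y.
Proof.
rewrite -big_split; apply: eq_bigr => i _ /=; rewrite ffunE.
by case: (a i) (x i) (y i) => [] [] [] /=; rewrite ?expr0 ?expr1 ?mulr1 ?mul1r ?mulrNN ?mulr1.
Qed.

Lemma chi0 a : chi a 0 = 1.
Proof. by apply: big1 => i _; rewrite ffunE andbF. Qed.

Lemma chi_sum (I : finType) (P : pred I) (F : I -> V) a :
  chi a (\sum_(i | P i) F i) = \prod_(i | P i) chi a (F i).
Proof. exact: (big_morph _ (chiD a) (chi0 a)). Qed.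

Lemma chi_unitv a i : chi a (unitv i) = (-1) ^+ a i.
Proof.
rewrite /chi (bigD1 i) //= big1 ?mulr1 ?ffunE ?eqxx ?andbT// => j ji.
by rewrite ffunE (negbTE ji) andbF.
Qed.

Lemma sum_chi x : \sum_a chi a x = (2 ^ k.+1)%:R * (x == 0)%:R.
Proof.
rewrite -(bigA_distr_bigA (fun i (b : bool) => (-1) ^+ (b && x i) : R)) /=.
rewrite (eq_bigr (fun i => 2 * (~~ x i)%:R)); last first.
  by move=> i _; rewrite big_bool /=; case: (x i); rewrite /= ?mulr0 ?addNr ?mulr1.
rewrite big_split /= prodr_const card_ord natrX; congr (_ * _).
case: eqP => [->|xn0]; first by rewrite big1 // => i _; rewrite ffunE.
have [i xi] : exists i, x i.
  apply/existsP; apply: contra_notT xn0; rewrite negb_exists => /forallP x0.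
  by apply/ffunP => i; rewrite ffunE; apply/negbTE/x0.
by rewrite (bigD1 i) //= xi mul0r.
Qed.

Lemma sum_chir a : \sum_x chi a x = (2 ^ k.+1)%:R * (a == 0)%:R.
Proof. by rewrite -sum_chi; apply: eq_bigr => x _; rewrite chiC. Qed.

(* Up to the factor [2 ^ k.+1], the number of length-[t] paths of the hypercube
   from [0] to [y], written in the basis of characters. *)
Definition paths t y : R := \sum_a chi a y * (\sum_i chi a (unitv i)) ^+ t.

Lemma pathsS t y : paths t.+1 y = \sum_i paths t (y + unitv i).
Proof.
rewrite exchange_big; apply: eq_bigr => a _ /=.
rewrite exprS mulrA mulr_sumr mulr_suml; apply: eq_bigr => i _.
by rewrite chiD.
Qed.

Lemma paths0 y : paths 0 y = (2 ^ k.+1)%:R * (y == 0)%:R.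
Proof. by rewrite -sum_chi; apply: eq_bigr => a _; rewrite mulr1. Qed.

Lemma paths_ge0 t y : 0 <= paths t y.
Proof.
elim: t y => [|t IH] y; first by rewrite paths0 mulr_ge0.
by rewrite pathsS sumr_ge0.
Qed.

Lemma sum_paths t : \sum_y paths t y = (2 ^ k.+1)%:R * k.+1%:R ^+ t.
Proof.
rewrite exchange_big /= (eq_bigr (fun a : V => (2 ^ k.+1)%:R * (a == 0)%:R *
    (\sum_i chi a (unitv i)) ^+ t)); last first.
  by move=> a _; rewrite -mulr_suml sum_chir.
rewrite (bigD1 (0 : V)) //= [X in _ + X]big1 ?addr0 => [|a /negbTE->]; last first.
  by rewrite mulr0 mul0r.
rewrite eqxx mulr1; congr (_ * _ ^+ t).
rewrite (eq_bigr (fun=> 1)) => [|i _]; last by rewrite chi_unitv ffunE.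
by rewrite sumr_const card_ord.
Qed.

(* In the recursion on [t], the two terms where the last step uses [i] or [j]
   are exchanged, and the others are compared by induction. *)
Lemma le_paths t y i j : i != j -> ~~ y i -> ~~ y j ->
  paths t (y + unitv i + unitv j) <= paths t y.
Proof.
move=> ij; elim: t y => [|t IH] y yi yj.
  rewrite !paths0 (_ : (_ + _ == 0) = false) ?mulr0 ?mulr_ge0//.
  apply/eqP => /ffunP/(_ i); rewrite !ffunE (negbTE ij) eqxx (negbTE yi); done.
rewrite !pathsS.
rewrite (bigD1 i) //= [X in _ <= X](bigD1 i) //=.
rewrite (bigD1 j) 1?eq_sym //= [X in _ <= _ + X](bigD1 j) 1?eq_sym //=.
have -> : y + unitv i + unitv j + unitv i = y + unitv j.
  by rewrite addrAC -(addrA y) addcc addr0.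
have -> : y + unitv i + unitv j + unitv j = y + unitv i.
  by rewrite -addrA addcc addr0.
rewrite !addrA [paths t (y + unitv j) + _]addrC lerD2l.
apply: ler_sum => l /andP[li lj].
rewrite addrAC (addrAC y); apply: IH.
  by rewrite !ffunE eq_sym (negbTE li) addr0.
by rewrite !ffunE eq_sym (negbTE lj) addr0.
Qed.

(** Removing two elements from [A] turns two zeros of the vector into ones, which by [le_paths] does
    not increase the count. So all-ones minimises [paths t] among the vectors of its parity. *)
Lemma le_paths_set t (A : {set 'I_k.+1}) : ~~ odd #|A| ->
  paths t (constv true) <= paths t [ffun i => i \notin A].
Proof.
have [n] := ubnP #|A|; elim: n A => // n IH A An evA.
have [A0|[i iA]] := set_0Vmem A.
  rewrite (_ : [ffun i => i \notin A] = constv true) //.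
  by apply/ffunP => i; rewrite !ffunE A0 inE.
have [A0|[j]] := set_0Vmem (A :\ i).
  by move: evA; rewrite (cardsD1 i) iA A0 cards0.
rewrite !inE => /andP[ji jA].
have cA : #|A| = #|A :\ i :\ j|.+2.
  by rewrite (cardsD1 i) iA (cardsD1 j) !inE ji jA.
rewrite cA /= negbK in An evA.
apply: le_trans (IH (A :\ i :\ j) _ evA) _; first exact: ltnW.
have := @le_paths t [ffun i => i \notin A] i j.
rewrite eq_sym ji !ffunE iA jA => /(_ isT isT isT).
congr (_ <= _); congr (paths t _); apply/ffunP => l; rewrite !ffunE !inE.
have [-> | lj] := eqVneq l j; first by rewrite jA (negbTE ji).
by have [-> | li] := eqVneq l i; rewrite ?iA //= !addr0.
Qed.

(** All-ones has the fewest paths within its parity class, which is half of the cube, so its count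
    is at most twice the average over the cube. *)
Lemma paths_ones t : paths t (constv true) <= 2 * k.+1%:R ^+ t.
Proof.
pose F (A : {set 'I_k.+1}) : V := [ffun i => i \notin A].
pose G (y : V) := [set i | ~~ y i].
have FK : cancel F G by move=> A; apply/setP => i; rewrite inE ffunE negbK.
have GK : cancel G F by move=> y; apply/ffunP => i; rewrite ffunE inE negbK.
(* Toggling [ord0] changes the parity, so exactly one of [A] and [D A] has even size. *)
pose D (A : {set 'I_k.+1}) := if ord0 \in A then A :\ ord0 else ord0 |: A.
have DK : involutive D.
  move=> A; rewrite /D; case: (boolP (ord0 \in A)) => A0.
    by rewrite !inE eqxx /= finset.setD1K.
  by rewrite !inE eqxx /= finset.setU1K.
have oddD A : odd #|D A| = ~~ odd #|A|.
  rewrite /D; case: (boolP (ord0 \in A)) => A0.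
    by rewrite [in RHS](cardsD1 ord0) A0 /= negbK.
  by rewrite cardsU1 A0.
have key A : paths t (constv true) <= paths t (F A) + paths t (F (D A)).
  have [oA|eA] := boolP (odd #|A|).
    by rewrite (le_trans (le_paths_set t (A := D A) _)) ?oddD ?oA // lerDr paths_ge0.
  by rewrite (le_trans (le_paths_set t eA)) // lerDl paths_ge0.
have sF : \sum_A paths t (F A) = (2 ^ k.+1)%:R * k.+1%:R ^+ t.
  rewrite -sum_paths [RHS](reindex F) //.
  by exists G => ? _; [exact: FK|exact: GK].
rewrite -(ler_pM2l (_ : 0 < (2 ^ k.+1)%:R :> R)) ?ltr0n ?expn_gt0 //.
rewrite mulrCA -sF mulrDl !mul1r [X in _ <= _ + X](reindex D) /=; last first.
  by exists D => ? _; exact: DK.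
rewrite -big_split /=.
have -> : (2 ^ k.+1)%:R * paths t (constv true) =
    \sum_(A : {set 'I_k.+1}) paths t (constv true).
  by rewrite sumr_const -cardsT -powersetT card_powerset cardsT card_ord mulr_natl.
exact: ler_sum.
Qed.

(** Steps outside [P] are free; the others form a path of length [#|P|] from 0 to all-ones, to which
    [paths_ones] applies. *)
Lemma sum_path_ones T (P : pred 'I_T) :
  (2 ^ k.+1)%:R *
  \sum_(f : {ffun 'I_T -> 'I_k.+1}) (\sum_(r | P r) unitv (f r) == constv true)%:R
  <= 2 * k.+1%:R ^+ T :> R.
Proof.
have -> : (2 ^ k.+1)%:R * \sum_(f : {ffun 'I_T -> 'I_k.+1})
    (\sum_(r | P r) unitv (f r) == constv true)%:R =
    k.+1%:R ^+ #|[predC P]| * paths #|P| (constv true) :> R.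
  (* Written as a character sum, the indicator is a product over the steps, so the sum over [f]
     factors. *)
  rewrite mulr_sumr; under eq_bigr => f _.
    rewrite -subr_eq0 oppc -sum_chi; under eq_bigr do rewrite chiD chi_sum mulrC.
    over.
  rewrite exchange_big /paths mulr_sumr; apply: eq_bigr => a _ /=.
  rewrite -mulr_sumr mulrCA; congr (_ * _).
  transitivity (\sum_(f : {ffun 'I_T -> 'I_k.+1})
      \prod_r (if P r then chi a (unitv (f r)) else 1)).
    by apply: eq_bigr => f _; rewrite big_mkcond.
  rewrite -(bigA_distr_bigA (fun r i => if P r then chi a (unitv i) else 1)) /=.
  rewrite (bigID P) /= mulrC; congr (_ * _).
    rewrite -prodr_const; apply: eq_bigr => r /negbTE Pr.
    by rewrite Pr sumr_const card_ord.
  by rewrite -prodr_const; apply: eq_bigr => r Pr; apply: eq_bigr => i _; rewrite Pr.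
have -> : k.+1%:R ^+ T = k.+1%:R ^+ #|[predC P]| * k.+1%:R ^+ #|P| :> R.
  by rewrite -exprD addnC cardC card_ord.
by rewrite mulrCA ler_wpM2l ?exprn_ge0 ?paths_ones.
Qed.
End Cube.

Lemma sum_marginal (R : numDomainType) (I X : finType) (j : I) (F : X -> R) :
  #|X|%:R * \sum_(w : {ffun I -> X}) F (w j) = #|{ffun I -> X}|%:R * \sum_x F x.
Proof.
have -> : \sum_(w : {ffun I -> X}) F (w j) =
    \sum_(w : {ffun I -> X}) \prod_i (if i == j then F (w i) else 1).
  by apply: eq_bigr => w _; rewrite -big_mkcond big_pred1_eq.
rewrite -(bigA_distr_bigA (fun i x => if i == j then F x else 1)) /=.
rewrite (bigD1 j) //= eqxx mulrCA mulrC; congr (_ * _).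
rewrite (eq_bigr (fun=> #|X|%:R)) => [|i /negbTE ->]; last first.
  by rewrite sumr_const.
rewrite prodr_const -exprS card_ffun natrX; congr (_ ^+ _).
by rewrite [RHS](cardD1 j) add1n; congr _.+1; apply: eq_card => i; rewrite !inE andbT.
Qed.

(** * Coupled walks and their coincidences modulo the antipodal map *)

Section Walks.
Context {k m T : nat}.
Local Notation V := {ffun 'I_k.+1 -> bool}.
Local Notation X := (V * {ffun 'I_T -> 'I_k.+1})%type.
Local Notation Omega := {ffun 'I_m -> X}.
Implicit Types (w : Omega) (p q : 'I_m * 'I_T.+1).

Definition displacement (s : 'I_k.+1 -> V) (f : {ffun 'I_T -> 'I_k.+1}) (t : nat) : V :=
  \sum_(r < T | (r < t)%N) s (f r).

Definition walk_pos (s : 'I_k.+1 -> V) (xf : X) (t : nat) : V :=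
  xf.1 + displacement s xf.2 t.

(** The folded walk is the hypercube walk plus all-ones times the parity of its steps along [ord0].
    Two visits to one antipodal pair with different parities are those that no single exchange of
    its labels can reconcile. *)
Definition entangled w p q : bool :=
  (fold (walk_pos unitv (w p.1) p.2) == fold (walk_pos unitv (w q.1) q.2)) &&
  (displacement unitv (w p.1).2 p.2 ord0 != displacement unitv (w q.1).2 q.2 ord0).

Definition bad w : bool := [exists p, [exists q, entangled w p q]].

(** The common start cancels, so the displacement between the two times is in the kernel of [fold];
    its coordinate at [ord0] is 1, which leaves only all-ones. *)
Lemma entangled_same w j t u : entangled w (j, t) (j, u) ->
  \sum_(r < T | (r < t)%N (+) (r < u)%N) unitv ((w j).2 r) = constv true.
Proof.
case/andP => /eqP /= e d.
have -> : \sum_(r < T | (r < t)%N (+) (r < u)%N) unitv ((w j).2 r) =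
    displacement unitv (w j).2 t + displacement unitv (w j).2 u.
  rewrite /displacement big_mkcond [X in X + _]big_mkcond [X in _ + X]big_mkcond.
  rewrite -big_split; apply: eq_bigr => r _ /=.
  by case: (r < t)%N; case: (r < u)%N; rewrite /= ?addcc ?addr0 ?add0r.
move: e; rewrite /walk_pos !foldD => /addrI e.
rewrite [LHS]fold_eq0 ?foldD ?e ?addcc // ffunE; congr constv.
by move: d; case: (displacement _ _ _ _); case: (displacement _ _ _ _).
Qed.

Context {R : numDomainType}.

Lemma sum_entangled p q :
  (2 ^ k.+1)%:R * \sum_w (entangled w p q)%:R <= 2 * #|Omega|%:R :> R.
Proof.
case: p q => [j t] [j' u].
have V_gt0 : 0 < (2 ^ k.+1)%:R :> R by rewrite ltr0n expn_gt0.
(* Within one walk, the steps between the two times must sum to all-ones, which [sum_path_ones]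
   bounds. *)
have [<-|jj'] := eqVneq j j'.
  have X_gt0 : 0 < #|{: X}|%:R :> R.
    rewrite ltr0n; apply/card_gt0P.
    by exists (0, [ffun=> ord0]).
  rewrite -(ler_pM2l X_gt0).
  pose P (r : 'I_T) := (r < t)%N (+) (r < u)%N.
  pose F (xf : X) : R := (\sum_(r | P r) unitv (xf.2 r) == constv true)%:R.
  have le_F : \sum_w (entangled w (j, t) (j, u))%:R <= \sum_(w : Omega) F (w j).
    apply: ler_sum => w _; rewrite /F.
    by case: (boolP (entangled _ _ _)) => [/entangled_same ->|_]; rewrite ?eqxx.
  apply: le_trans (ler_wpM2l (ltW X_gt0) (ler_wpM2l (ltW V_gt0) le_F)) _.
  rewrite mulrCA sum_marginal mulrCA [leRHS]mulrA [leRHS]mulrC ler_wpM2l //.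
  have -> : \sum_x F x = (2 ^ k.+1)%:R *
      \sum_(f : {ffun 'I_T -> 'I_k.+1}) (\sum_(r | P r) unitv (f r) == constv true)%:R.
    transitivity (\sum_(x : V) \sum_(f : {ffun 'I_T -> 'I_k.+1}) F (x, f)).
      by rewrite pair_bigA; apply: eq_bigr => -[].
    by rewrite /F /= sumr_const card_cube mulr_natl.
  rewrite card_prod card_cube natrM card_ffun !card_ord.
  rewrite -[leRHS]mulrA ler_pM2l // [leRHS]mulrC.
  by rewrite [in leRHS]natrX sum_path_ones.
(* For two different walks, average over all translations [v] of the start of walk [j]: for each [w]
   at most two values of [v], differing by all-ones, entangle the visits. *)
pose shift (v : V) w : Omega :=
  [ffun i => (if i == j then (w i).1 + v else (w i).1, (w i).2)].
have shiftK v : involutive (shift v).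
  move=> w; apply/ffunP => i; rewrite !ffunE /=.
  by case: (w i) => a b /=; case: eqP => // _; rewrite -addrA addcc addr0.
have -> : (2 ^ k.+1)%:R * (\sum_w (entangled w (j, t) (j', u))%:R : R) =
   \sum_(v : V) \sum_w (entangled (shift v w) (j, t) (j', u))%:R :> R.
  rewrite -card_cube mulr_natl -sumr_const; apply: eq_bigr => v _.
  by rewrite (reindex (shift v)) //; exists (shift v) => w _; exact: shiftK.
rewrite exchange_big /= mulr_natr -sumr_const; apply: ler_sum => w _.
pose c := walk_pos unitv (w j) t + walk_pos unitv (w j') u.
apply: (@le_trans _ R (\sum_(v : V) ((v == c)%:R + (v == c + constv true)%:R))); last first.
  rewrite big_split /=.
  rewrite (bigD1 c) //= big1 ?addr0 => [|v /negbTE ->//]; rewrite eqxx.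
  rewrite (bigD1 (c + constv true)) //= big1 ?addr0 => [|v /negbTE ->//].
  by rewrite eqxx.
apply: ler_sum => v _.
case: (boolP (entangled _ _ _)) => [/andP[/eqP/= e _]|_]; last by rewrite addr_ge0.
have {e} : fold (v + c) = 0.
  move/eqP: e; rewrite eq_sym in jj'; rewrite /walk_pos !ffunE /= eqxx (negbTE jj').
  rewrite -subr_eq0 oppc -foldD => /eqP <-; congr fold.
  by rewrite /c /walk_pos [_ + v]addrC -!addrA.
move/fold_eq0 => e.
have -> : v = c + constv ((v + c) ord0).
  by rewrite -e addrCA addcc addr0.
case: ((v + c) ord0); first by rewrite eqxx lerDr.
by rewrite constv0 addr0 eqxx lerDl.
Qed.

(** Union bound over the (m (T + 1))^2 pairs of visits. Since m (T + 1) <= 2 m T once T > 0, the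
    constant is 2 * 2^2 = 8; the case m T = 0 has no entangled visits. *)
Lemma sum_bad :
  (2 ^ k.+1)%:R * \sum_w (bad w)%:R <= 8 * (m * T)%:R ^+ 2 * #|Omega|%:R :> R.
Proof.
have [mT0|mT_gt0] := posnP (m * T)%N.
  rewrite big1 ?mulr0 ?mulr_ge0 ?exprn_ge0 // => w _.
  case: (boolP (bad w)) => // /existsP[[j t] /existsP[[j' u] /andP[_]]] /=.
  have T0 : T = 0%N.
    move/eqP: mT0; rewrite muln_eq0 => /orP[/eqP m0|/eqP//].
    by have := leq_trans (ltn_ord j) (eq_leq m0).
  by rewrite /displacement !big1 ?eqxx // => r _; have := leq_trans (ltn_ord r) (eq_leq T0).
apply: (@le_trans _ R (\sum_(p : 'I_m * 'I_T.+1) \sum_(q : 'I_m * 'I_T.+1)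
    (2 ^ k.+1)%:R * \sum_w (entangled w p q)%:R)).
  have -> : \sum_(p : 'I_m * 'I_T.+1) \sum_(q : 'I_m * 'I_T.+1)
      (2 ^ k.+1)%:R * (\sum_w (entangled w p q)%:R : R) = (2 ^ k.+1)%:R *
      \sum_w \sum_(p : 'I_m * 'I_T.+1) \sum_(q : 'I_m * 'I_T.+1) (entangled w p q)%:R.
    rewrite [in RHS]exchange_big mulr_sumr; apply: eq_bigr => p _ /=.
    by rewrite [in RHS]exchange_big mulr_sumr.
  rewrite ler_wpM2l //.
  apply: ler_sum => w _; case: (boolP (bad w)) => [/existsP[p /existsP[q pq]]|_].
    rewrite (bigD1 p) //= (bigD1 q) //= pq -addrA lerDl addr_ge0 ?sumr_ge0 // => ? _.
    by rewrite sumr_ge0.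
  by rewrite sumr_ge0 // => ? _; rewrite sumr_ge0.
apply: (@le_trans _ R (\sum_(p : 'I_m * 'I_T.+1) \sum_(q : 'I_m * 'I_T.+1)
    2 * #|Omega|%:R)).
  by apply: ler_sum => p _; apply: ler_sum => q _; exact: sum_entangled.
rewrite !sumr_const -mulrnA !card_prod !card_ord -[leLHS]mulr_natl mulrA ler_wpM2r //.
rewrite -natrX -!natrM ler_nat.
have : (m * T.+1 <= 2 * (m * T))%N.
  rewrite mulnCA leq_mul2l mul2n -addnn -addn1 leq_add2l.
  by case: T mT_gt0 => [|?]; rewrite ?muln0 ?orbT.
move=> /[dup] h /(leq_mul h) /leq_mul/(_ (leqnn 2)) h2.
by rewrite (leq_trans h2)// mulnACA -mulnn mulnC mulnA.
Qed.

(** Exchanges the labels in the antipodal pairs selected by [g]; reading [g] at [fold y] gives both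
    points of a pair the same decision. *)
Definition gauge (g : {ffun V -> bool}) (y : V) : V := y + constv (g (fold y)).

Lemma gaugeK g : involutive (gauge g).
Proof.
by move=> y; rewrite /gauge foldD fold_constv addr0 -addrA addcc addr0.
Qed.

(** On a good outcome the parity of the steps along [ord0] is a function of the antipodal pair
    visited, and this function is [d]. As [g + d] is uniform when [g] is, the two walks then have
    equally distributed labels. *)
Lemma gauge_good w : ~~ bad w -> exists d : {ffun V -> bool},
  forall g j (t : 'I_T.+1), gauge g (walk_pos unitv (w j) t) =
    gauge (g + d) (walk_pos foldedv (w j) t).
Proof.
move=> good.
(* [D p] is the parity of the steps along [ord0], which is what separates the
   hypercube walk from the folded one. *)
pose D p := displacement unitv (w p.1).2 p.2 ord0.
exists [ffun v => [exists p : 'I_m * 'I_T.+1, (fold (walk_pos unitv (w p.1) p.2) == v) && D p]].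
move=> g j t.
have -> : walk_pos foldedv (w j) t =
    walk_pos unitv (w j) t + constv (D (j, t)).
  rewrite /walk_pos -addrA; congr (_ + _).
  by rewrite /displacement -fold_sum.
rewrite /gauge [in RHS]foldD fold_constv addr0 2!ffunE -[RHS]addrA; congr (_ + _).
rewrite -constvD; congr constv.
set b := [exists p, _]; suff -> : b = D (j, t) by rewrite addrCA; case: (D _); rewrite addr0.
apply/existsP/idP => [[p /andP[/eqP pv Dp]]|Dj]; last by exists (j, t); rewrite eqxx.
apply: contraNT good => Dj; apply/existsP; exists p; apply/existsP; exists (j, t).
by rewrite /entangled pv eqxx -/(D p) -/(D (j, t)) Dp (negbTE Dj).
Qed.
End Walks.

(** * Cayley graphs of F_2^n: spectrum and walk law *)

Section CayleyGraph.
Context {R : realType} {k : nat}.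
Local Notation V := {ffun 'I_k.+1 -> bool}.
Context (sg : V -> V) (sgK : involutive sg) (s : 'I_k.+1 -> V).
Local Notation N := #|{: V}|.

(** The involution [sg] acts on the naming of the vertices only: it changes the transcripts but not
    the spectrum. *)
Definition vertex (u : 'I_N) : V := sg (enum_val u).
Definition vlabel (y : V) : 'I_N := enum_rank (sg y).

Lemma vertexK : cancel vertex vlabel.
Proof. by move=> u; rewrite /vlabel /vertex sgK enum_valK. Qed.

Lemma vlabelK : cancel vlabel vertex.
Proof. by move=> y; rewrite /vlabel /vertex enum_rankK sgK. Qed.

Lemma sum_vertex (F : V -> R) : \sum_u F (vertex u) = \sum_y F y.
Proof.
rewrite [RHS](reindex vertex) //; exists vlabel => x _.
  exact: vertexK.
exact: vlabelK.
Qed.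

(** Generators count with multiplicity, which keeps the degree at n even where folded generators
    vanish (n = 1) or coincide (n = 2). *)
Definition cayley_adj : 'M[R]_N :=
  \matrix_(u, v) \sum_i (vertex u + s i == vertex v)%:R.

Lemma cayley_order_gt0 : (0 < N)%N.
Proof. by rewrite card_cube expn_gt0. Qed.

Lemma cayley_adj_sym u v : cayley_adj u v = cayley_adj v u.
Proof.
rewrite !mxE; apply: eq_bigr => i _; congr (_%:R); congr nat_of_bool.
by rewrite eq_sym -subr_eq oppc.
Qed.

Lemma cayley_adj_ge0 u v : 0 <= cayley_adj u v.
Proof. by rewrite mxE sumr_ge0. Qed.

Lemma cayley_degree v : \sum_u cayley_adj v u = k.+1%:R.
Proof.
under eq_bigr do rewrite mxE.
rewrite exchange_big /= (eq_bigr (fun=> 1)) => [|i _].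
  by rewrite sumr_const card_ord.
rewrite (sum_vertex (fun y => (vertex v + s i == y)%:R)).
rewrite (bigD1 (vertex v + s i)) //= eqxx big1 ?addr0 // => y.
by rewrite eq_sym => /negbTE ->.
Qed.

Lemma cayley_rowsum_gt0 v : 0 < \sum_u cayley_adj v u.
Proof. by rewrite cayley_degree. Qed.

Definition cayley : wgraph R :=
  WGraph cayley_order_gt0 cayley_adj_sym cayley_adj_ge0 cayley_rowsum_gt0.

Definition cayley_eig (a : V) : R := k.+1%:R^-1 * \sum_i chi a (s i).

Lemma normalized_adj_cayley :
  normalized_adj cayley = k.+1%:R^-1 *: cayley_adj :> 'M[R]_N.
Proof.
rewrite /normalized_adj /=.
have -> : \row_v (Num.sqrt (degree (G := cayley) v))^-1 =
    const_mx (Num.sqrt k.+1%:R)^-1 :> 'rV[R]_N.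
  by apply/rowP => v; rewrite !mxE /degree /= cayley_degree.
rewrite diag_const_mx mul_scalar_mx -scalemxAl mul_mx_scalar scalerA.
by rewrite -invfM -expr2 sqr_sqrtr.
Qed.

Definition chi_mx : 'M[R]_N := \matrix_(a, u) chi (enum_val a) (vertex u).

(** By orthogonality of characters the inverse is the transpose divided by 2^n. *)
Lemma chi_mx_unit : chi_mx \in unitmx.
Proof.
apply: (proj1 (mulmx1_unit (B := (2 ^ k.+1)%:R^-1 *: chi_mx^T) _)).
rewrite -scalemxAr; apply/matrixP => a b; rewrite !mxE.
under eq_bigr do rewrite !mxE ![chi (enum_val _) _]chiC -chiD chiC.
rewrite (sum_vertex (chi _)) sum_chir -[in X in X == 0](oppc (enum_val b)) subr_eq0.
by rewrite (inj_eq enum_val_inj) mulrA mulVf ?mul1r // pnatr_eq0 -lt0n expn_gt0.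
Qed.

(** Characters are eigenvectors for every choice of generators, so [chi_mx] conjugates the
    normalized adjacency matrix to a diagonal one. *)
Lemma char_poly_cayley :
  char_poly (normalized_adj cayley : 'M[R]_N) = \prod_(a : V) ('X - (cayley_eig a)%:P).
Proof.
pose D : 'M[R]_N := diag_mx (\row_a cayley_eig (enum_val a)).
have E : chi_mx *m (normalized_adj cayley : 'M[R]_N) = D *m chi_mx.
  rewrite normalized_adj_cayley -scalemxAr mul_diag_mx; apply/matrixP => a v; rewrite !mxE.
  rewrite -mulrA; congr (_ * _).
  under eq_bigr do rewrite !mxE mulr_sumr.
  rewrite exchange_big mulr_suml; apply: eq_bigr => i _ /=.
  rewrite (sum_vertex (fun y => chi (enum_val a) y * (y + s i == vertex v)%:R)).
  rewrite (bigD1 (vertex v + s i)) //= big1 ?addr0 => [|y].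
    by rewrite -addrA addcc addr0 eqxx mulr1 chiD mulrC.
  by rewrite -subr_eq oppc => /negbTE ->; rewrite mulr0.
have -> : (normalized_adj cayley : 'M[R]_N) = invmx chi_mx *m D *m chi_mx.
  by rewrite -mulmxA -E mulKmx // chi_mx_unit.
rewrite char_poly_conj ?chi_mx_unit // char_poly_trig; last first.
  exact/is_diag_mx_is_trig/diag_mx_is_diag.
rewrite [RHS](reindex (@enum_val _ (mem {: V}))) /=; last first.
  by exists enum_rank => a _; rewrite ?enum_valK ?enum_rankK.
by apply: eq_bigr => a _; rewrite !mxE eqxx mulr1n.
Qed.

Lemma sum_eigenvalues_cayley (F : R -> R) :
  \sum_(i < Defs.order cayley) F (tnth (eigenvalues cayley) i) = \sum_a F (cayley_eig a).
Proof.
have p : perm_eq (eigenvalues cayley) [seq cayley_eig a | a <- index_enum _].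
  apply: prod_XsubC_eq; rewrite -char_poly_eigenvalues char_poly_cayley.
  by rewrite big_map.
rewrite -(big_tuple _ _ (eigenvalues cayley) predT F).
by rewrite (perm_big _ p) big_map.
Qed.

Context {m T : nat}.
Local Notation X := (V * {ffun 'I_T -> 'I_k.+1})%type.
Local Notation Omega := {ffun 'I_m -> X}.

Definition trajectory (xf : X) : T.+1.-tuple 'I_N :=
  [tuple vlabel (walk_pos s xf t) | t < T.+1].

Definition trajectories (w : Omega) : m.-tuple (T.+1.-tuple 'I_N) :=
  [tuple trajectory (w j) | j < m].

Lemma prod_natr_bool (I : finType) (P : pred I) :
  \prod_i (P i)%:R = [forall i, P i]%:R :> R.
Proof.
case: (boolP [forall i, P i]) => [/forallP PT|]; first by rewrite big1 // => i _; rewrite PT.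
by rewrite negb_forall => /existsP[i /negbTE Pi]; rewrite (bigD1 i) //= Pi mul0r.
Qed.

Lemma walk_posS (xf : X) (t : 'I_T) : walk_pos s xf t.+1 = walk_pos s xf t + s (xf.2 t).
Proof.
rewrite /walk_pos -addrA; congr (_ + _); rewrite /displacement (bigD1 t) //= addrC.
congr (_ + _); apply: eq_bigl => r; rewrite ltnS ltn_neqAle andbC; congr (_ && _).
Qed.

Lemma walk_pos0 (xf : X) : walk_pos s xf 0 = xf.1.
Proof. by rewrite /walk_pos /displacement big1 ?addr0. Qed.

Lemma trajectory_eq (xf : X) (w : T.+1.-tuple 'I_N) :
  (trajectory xf == w) = (xf.1 == vertex (tnth w ord0)) &&
    [forall t : 'I_T, vertex (tnth w (widen_ord (leqnSn T) t)) + s (xf.2 t)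
                   == vertex (tnth w (lift ord0 t))].
Proof.
apply/eqP/andP => [<-|[/eqP x0 /forallP st]].
  split; first by rewrite tnth_mktuple vlabelK walk_pos0.
  by apply/forallP => t; rewrite !tnth_mktuple !vlabelK -walk_posS.
have pos (t : nat) (tT : (t < T.+1)%N) : walk_pos s xf t = vertex (tnth w (Ordinal tT)).
  elim: t tT => [|t IH] tT.
    by rewrite walk_pos0 x0; congr (vertex (tnth w _)); apply/val_inj.
  have tT' : (t < T)%N by [].
  rewrite (walk_posS _ (Ordinal tT')) (IH (leqW tT')).
  have := st (Ordinal tT') => /eqP; rewrite /=.
  rewrite (_ : widen_ord _ _ = Ordinal (leqW tT')); last exact/val_inj.
  by rewrite (_ : lift _ _ = Ordinal tT); last exact/val_inj.
apply: eq_from_tnth => -[t tT]; rewrite tnth_mktuple (pos t tT) vertexK.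
by [].
Qed.

(** Distributing the product of transition sums over all generator choices counts the pairs of a
    start and a choice sequence that trace [w]. *)
Lemma walk_prob_cayley (w : T.+1.-tuple 'I_N) :
  walk_prob (G := cayley) w = #|{: X}|%:R^-1 * \sum_xf (trajectory xf == w)%:R.
Proof.
have cX : #|{: X}|%:R = #|{: V}|%:R * k.+1%:R ^+ T :> R.
  by rewrite card_prod natrM; congr (_ * _); rewrite card_ffun !card_ord natrX.
rewrite /walk_prob /= cX invfM -mulrA.
congr (_ * _).
have tr u v : transition_mx cayley u v = k.+1%:R^-1 * \sum_i (vertex u + s i == vertex v)%:R.
  by rewrite /transition_mx mul_diag_mx !mxE /degree /= cayley_degree.
under eq_bigr do rewrite tr; rewrite big_split /= prodr_const card_ord exprVn.
congr (_ * _).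
rewrite bigA_distr_bigA /=.
under [RHS]eq_bigr do rewrite trajectory_eq -mulnb natrM -prod_natr_bool.
rewrite -(pair_bigA _ (fun x (f : {ffun 'I_T -> 'I_k.+1}) =>
  (x == vertex (tnth w ord0))%:R * \prod_(t < T)
    (vertex (tnth w (widen_ord (leqnSn T) t)) + s (f t) ==
     vertex (tnth w (lift ord0 t)))%:R)) /=.
rewrite [RHS](bigD1 (vertex (tnth w ord0))) //= [X in _ + X]big1 ?addr0 => [|x /negbTE ->].
  by rewrite eqxx -mulr_sumr mul1r.
by rewrite -mulr_sumr mul0r.
Qed.

Lemma walks_prob_cayley (W : m.-tuple (T.+1.-tuple 'I_N)) :
  walks_prob (G := cayley) W = #|{: Omega}|%:R^-1 * \sum_w (trajectories w == W)%:R.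
Proof.
rewrite /walks_prob; under eq_bigr do rewrite walk_prob_cayley.
rewrite big_split /= prodr_const card_ord exprVn; congr (_ * _).
  by rewrite card_ffun card_ord natrX.
rewrite bigA_distr_bigA /=; apply: eq_bigr => w _; rewrite prod_natr_bool.
congr (_%:R); congr nat_of_bool; apply/forallP/eqP => [E|<- j]; last first.
  by rewrite tnth_mktuple.
by apply: eq_from_tnth => j; rewrite tnth_mktuple; exact/eqP.
Qed.

(** [Omega] does not depend on the generators, so this change of variables puts both graphs on one
    probability space. *)
Lemma sum_walks_cayley (H : m.-tuple (T.+1.-tuple 'I_N) -> R) :
  \sum_W walks_prob (G := cayley) W * H W =
  #|{: Omega}|%:R^-1 * \sum_w H (trajectories w).
Proof.
under eq_bigr do rewrite walks_prob_cayley -mulrA.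
rewrite -mulr_sumr; congr (_ * _).
under eq_bigr do rewrite mulr_suml.
rewrite exchange_big; apply: eq_bigr => w _ /=.
rewrite (bigD1 (trajectories w)) //= eqxx mul1r big1 ?addr0 // => W.
by rewrite eq_sym => /negbTE ->; rewrite mul0r.
Qed.
End CayleyGraph.

(** * Lipschitz test functions and W1 *)

Section Wasserstein.
Context {R : realType}.
Local Notation RB := (measurableTypeR R).
Implicit Types (p q : probability RB R) (f : RB -> R).
Local Open Scope ereal_scope.

Lemma coupling_integral (p q : probability RB R) (psi : probability (RB * RB)%type R) f :
  coupling p q psi -> measurable_fun setT f -> (forall x, (0 <= f x)%R) ->
  \int[psi]_z (f z.1)%:E = \int[p]_x (f x)%:E /\
  \int[psi]_z (f z.2)%:E = \int[q]_x (f x)%:E.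
Proof.
move=> [psi1 psi2] mf f0.
have mf' : measurable_fun setT (EFin \o f) by exact/measurable_EFinP.
split.
- rewrite [RHS](eq_measure_integral (pushforward psi (@fst RB RB))) => [|A mA _].
    by rewrite (ge0_integral_pushforward measurable_fst) // => x _; rewrite lee_fin.
  apply: etrans (esym (psi1 A mA)) _; rewrite /pushforward; congr (psi _).
  apply/seteqP; split => -[x y] /=.
    by case.
  by [].
- rewrite [RHS](eq_measure_integral (pushforward psi (@snd RB RB))) => [|A mA _].
    by rewrite (ge0_integral_pushforward measurable_snd) // => x _; rewrite lee_fin.
  apply: etrans (esym (psi2 A mA)) _; rewrite /pushforward; congr (psi _).
  apply/seteqP; split => -[x y] /=.
    by case.
  by [].
Qed.

(** The easy half of Kantorovich duality. The bound [M] makes the integrals finite, so they can be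
    moved across the infimum over couplings. *)
Lemma lipschitz_W1 (p q : probability RB R) f (M : R) : measurable_fun setT f ->
  (forall x, (0 <= f x <= M)%R) -> (forall x y, (f x <= f y + `|x - y|)%R) ->
  \int[p]_x (f x)%:E <= \int[q]_x (f x)%:E + W1 p q /\
  \int[q]_x (f x)%:E <= \int[p]_x (f x)%:E + W1 p q.
Proof.
move=> mf f0M lip.
have f0 x : (0 <= f x)%R by case/andP: (f0M x).
have mf' : measurable_fun setT (EFin \o f) by exact/measurable_EFinP.
have fin (r : probability RB R) : \int[r]_x (f x)%:E \is a fin_num.
  rewrite ge0_fin_numE; last by apply: integral_ge0 => x _; rewrite lee_fin.
  apply: (@le_lt_trans _ _ (\int[r]_x (cst M%:E x))).
    apply: ge0_le_integral => //.
    - by move=> x _; rewrite lee_fin.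
    - by move=> x _; rewrite lee_fin; case/andP: (f0M x).
  have -> : \int[r]_x (cst M%:E x) = M%:E; last exact: ltry.
  by rewrite integral_cst // -[RHS]mule1; congr (_ * _); exact: probability_setT.
have m1 : measurable_fun setT (EFin \o (fun z : RB * RB => f z.1)).
  by apply/measurable_EFinP; apply: measurableT_comp => //; exact: measurable_fst.
have m2 : measurable_fun setT (EFin \o (fun z : RB * RB => f z.2)).
  by apply/measurable_EFinP; apply: measurableT_comp => //; exact: measurable_snd.
have md : measurable_fun setT (EFin \o (fun z : RB * RB => `|z.1 - z.2|%R)).
  apply/measurable_EFinP; apply: measurableT_comp => //.
  by apply: measurable_funB; [exact: measurable_fst|exact: measurable_snd].
split; rewrite -leeBlDl //; apply: le_ereal_inf_tmp => _ [psi cpl <-]; rewrite leeBlDl //.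
- have [<- <-] := coupling_integral cpl mf f0.
  rewrite -ge0_integralD //; try by move=> *; rewrite lee_fin.
  apply: ge0_le_integral => //.
  - by move=> *; rewrite lee_fin.
  - exact: emeasurable_funD.
  - by move=> z _; rewrite -EFinD lee_fin.
- have [<- <-] := coupling_integral cpl mf f0.
  rewrite -ge0_integralD //; try by move=> *; rewrite lee_fin.
  apply: ge0_le_integral => //.
  - by move=> *; rewrite lee_fin.
  - exact: emeasurable_funD.
  - by move=> z _; rewrite -EFinD lee_fin distrC.
Qed.

Lemma integral_spectral_density (G : wgraph R) f : measurable_fun setT f ->
  (forall x, (0 <= f x)%R) ->
  \int[spectral_density G]_x (f x)%:E =
  ((Defs.order G)%:R^-1 * \sum_(i < Defs.order G) f (tnth (eigenvalues G) i))%:E.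
Proof.
move=> mf f0.
have mf' : measurable_fun setT (EFin \o f) by exact/measurable_EFinP.
have invN_ge0 : (0 <= (Defs.order G)%:R^-1 :> R)%R by rewrite invr_ge0.
rewrite (eq_measure_integral (mscale (NngNum invN_ge0)
   (msum (fun k => \d_((eigenvalues G)`_k%R : RB)) (Defs.order G)))) => [|A mA _]; last first.
  rewrite /mscale /msum /spectral_density /=.
  by congr (_ * _); apply: eq_bigr => i _; rewrite (tnth_nth 0%R).
rewrite ge0_integral_mscale //; last by move=> *; rewrite lee_fin.
rewrite ge0_integral_measure_sum //; last by move=> *; rewrite lee_fin.
rewrite EFinM -sumEFin; congr (_ * _); apply: eq_bigr => i _.
by rewrite integral_dirac // diracT mul1e (tnth_nth 0%R).
Qed.

End Wasserstein.

(** * Inner measure *)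

Section InnerProbability.
Context {R : realType} {d : measure_display} {O : measurableType d}.
Context (P : probability O R).
Local Open Scope ereal_scope.
Local Open Scope classical_set_scope.

Lemma inner_prob_ge0 E : 0 <= inner_prob P E.
Proof.
by apply: ereal_sup_ubound; exists set0; rewrite ?measure0 //; split.
Qed.

Lemma inner_prob_le1 E : inner_prob P E <= 1.
Proof. by apply: ge_ereal_sup => _ [B [mB _] <-]; exact: probability_le1. Qed.

Lemma le_inner_prob E F : E `<=` F -> inner_prob P E <= inner_prob P F.
Proof.
move=> EF; apply: ge_ereal_sup => _ [B [mB BE] <-].
by apply: ereal_sup_ubound; exists B => //; split => // x /BE /EF.
Qed.

Lemma inner_prob_fin_num E : inner_prob P E \is a fin_num.
Proof.
by rewrite ge0_fin_numE ?inner_prob_ge0 // (le_lt_trans (inner_prob_le1 E)) ?ltry.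
Qed.

(** Measurable subsets of [E] and of [F] are disjoint, so their measures add up to at most 1; then
    take suprema one at a time. *)
Lemma inner_prob_disjoint E F : E `&` F = set0 ->
  inner_prob P E + inner_prob P F <= 1.
Proof.
move=> EF0; rewrite -leeBrDr ?inner_prob_fin_num //.
apply: ge_ereal_sup => _ [B [mB BE] <-].
have PBfin : P B \is a fin_num by exact: fin_num_measure.
rewrite leeBrDr ?inner_prob_fin_num // addeC -leeBrDr //.
apply: ge_ereal_sup => _ [C [mC CF] <-].
rewrite leeBrDr // -measureU //; first by rewrite probability_le1 //; exact: measurableU.
by apply/seteqP; split => // x [/CF Fx /BE Ex]; rewrite -EF0.
Qed.
End InnerProbability.

(** * The test function and the two spectra *)

Section TestFunction.
Context {R : realType} {k : nat}.
Local Notation V := {ffun 'I_k.+1 -> bool}.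
Local Notation n := (k.+1%:R : R).

Definition level (j : nat) : R := 1 - 2 * j%:R / n.

(* The truncation at the gap [2 / n] keeps the function bounded, so that its
   integral against any output distribution is finite. *)
Definition even_dist (x : R) : R :=
  \big[Num.min/2 / n]_(j < k.+2 | ~~ odd j) `|x - level j|.

Lemma even_dist_bound x : 0 <= even_dist x <= 2 / n.
Proof. by rewrite bigmin_le_id le_bigmin // divr_ge0. Qed.

Lemma even_dist_lip x y : even_dist x <= even_dist y + `|x - y|.
Proof.
rewrite -lerBlDr; apply: le_bigmin => [|j ev].
  by rewrite lerBlDr (le_trans (bigmin_le_id _ _ _ _)) // lerDl.
rewrite lerBlDr [leRHS]addrC.
apply: le_trans (bigmin_le_cond _ (fun i : 'I_k.+2 => `|x - level i|) ev) _.
by rewrite (le_trans _ (ler_normD _ _)) // addrA subrK.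
Qed.

Lemma measurable_even_dist :
  measurable_fun setT (even_dist : measurableTypeR R -> measurableTypeR R).
Proof.
rewrite /even_dist; elim: (index_enum _) => [|j r IH].
  by under eq_fun do rewrite big_nil; exact: measurable_cst.
under eq_fun do rewrite big_cons.
case: (odd j) => //=.
apply: measurable_minr => //; apply: measurableT_comp => //.
by apply: measurable_funB.
Qed.

Lemma even_dist_even j : (j <= k.+1)%N -> ~~ odd j -> even_dist (level j) = 0.
Proof.
move=> jk ev; apply/eqP; rewrite eq_le; case/andP: (even_dist_bound (level j)) => -> _.
rewrite andbT; have := bigmin_le_cond (2 / n) (fun i : 'I_k.+2 => `|level j - level i|)
  (j := Ordinal (jk : (j < k.+2)%N)) (P := fun i => ~~ odd i) ev.
by rewrite subrr normr0.
Qed.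

(** Every even level is at least 2 / n away, so the minimum is its default value. *)
Lemma even_dist_odd j : odd j -> even_dist (level j) = 2 / n.
Proof.
move=> oj; apply: bigmin_eq_id => i ei.
have -> : level j - level i = 2 * (i%:R - j%:R) / n by rewrite /level; ring.
rewrite normrM.
rewrite [X in _ <= _ * X]ger0_norm ?invr_ge0 // ler_pM2r ?invr_gt0 ?ltr0n //.
rewrite normrM ger0_norm // ler_peMr //.
have ij : (i : nat) != j by apply: contraNneq ei => ->.
rewrite -[i%:R]/((i : int)%:~R) -[j%:R]/((j : int)%:~R) -intrB -intr_norm ler1z.
by rewrite -gtz0_ge1 normr_gt0 subr_eq0.
Qed.

Definition weight (a : V) : nat := \sum_i a i.

Lemma weight_le a : (weight a <= k.+1)%N.
Proof.
rewrite -[leqRHS]card_ord -sum1_card.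
by apply: leq_sum => i _; exact: leq_b1.
Qed.

Lemma chi_ones a : chi a (constv true) = (-1) ^+ weight a :> R.
Proof.
by rewrite /weight -prodrXr; apply: eq_bigr => i _; rewrite ffunE andbT.
Qed.

Lemma cube_eig a : cayley_eig unitv a = level (weight a).
Proof.
rewrite /cayley_eig /level.
have -> : \sum_i chi a (unitv i) = n - 2 * (weight a)%:R.
  rewrite natr_sum mulr_sumr (_ : n = \sum_(i < k.+1) 1) -?sumrB; last first.
    by rewrite sumr_const card_ord.
  apply: eq_bigr => i _; rewrite chi_unitv; case: (a i) => /=.
    by rewrite expr1 mulr1 -[2]/(1 + 1) opprD addNKr.
  by rewrite mulr0 subr0.
by rewrite mulrBr mulVf ?pnatr_eq0 // mulrC.
Qed.

(** Folding changes only the term at [ord0], by the factor (-1)^(weight a). For odd weight this sign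
    flip amounts to adding [unitv ord0] to [a], which makes the weight even. *)
Lemma folded_eig (a : V) : exists2 b : V, ~~ odd (weight b) &
  cayley_eig foldedv a = level (weight b).
Proof.
have chi_fold i : chi a (foldedv i) =
    chi a (unitv i) * ((-1) ^+ weight a) ^+ (i == ord0) :> R.
  rewrite chiD ffunE eq_sym; case: eqP => _; first by rewrite chi_ones.
  by rewrite constv0 chi0.
have [oa|ea] := boolP (odd (weight a)); last first.
  exists a => //; rewrite -cube_eig /cayley_eig; congr (_ * _).
  by apply: eq_bigr => i _; rewrite chi_fold -signr_odd (negbTE ea) expr1n mulr1.
(* The parity is read off the character at all-ones, which is multiplicative. *)
have ob : ~~ odd (weight (a + unitv ord0)).
  have := chi_ones (a + unitv ord0).
  rewrite chiC chiD !(chiC (constv true)) !chi_ones.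
  rewrite (_ : weight (unitv ord0) = 1%N); last first.
    by rewrite /weight (bigD1 ord0) //= ffunE eqxx big1 // => i /negbTE i0; rewrite ffunE i0.
  rewrite -signr_odd oa mulrNN mulr1 -[RHS]signr_odd.
  by case: odd => // /eqP; rewrite expr1 -subr_eq0 opprK (pnatr_eq0 _ 2).
exists (a + unitv ord0) => //; rewrite -cube_eig /cayley_eig; congr (_ * _).
apply: eq_bigr => i _; rewrite chi_fold [RHS]chiC chiD !(chiC (unitv i)).
congr (_ * _); rewrite -signr_odd oa expr1 chi_unitv ffunE; congr (_ ^+ _).
Qed.

(** The distance is 2 / n at odd weights and 0 at even ones, hence affine in the character at
    all-ones, whose sum over all [a] vanishes. *)
Lemma sum_cube_even_dist :
  \sum_(a : V) even_dist (cayley_eig unitv a) = (2 ^ k.+1)%:R / n.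
Proof.
have E (a : V) : even_dist (cayley_eig unitv a) = (1 - chi a (constv true)) / n.
  rewrite cube_eig chi_ones -signr_odd; have [oa|ea] := boolP (odd _).
    by rewrite even_dist_odd // expr1 opprK.
  by rewrite even_dist_even ?weight_le // subrr mul0r.
under eq_bigr do rewrite E.
rewrite -mulr_suml sumrB sum_chi sumr_const card_cube.
rewrite (_ : (constv true == 0) = false) ?mulr0 ?subr0 //.
by apply/eqP => /ffunP/(_ ord0); rewrite !ffunE.
Qed.

Lemma sum_folded_even_dist :
  \sum_(a : V) even_dist (cayley_eig foldedv a) = 0.
Proof.
apply: big1 => a _; have [b eb ->] := folded_eig a.
by rewrite even_dist_even ?weight_le.
Qed.

Section Densities.
Context (sg : V -> V) (sgK : involutive sg).

Lemma integral_cube :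
  (\int[spectral_density (cayley sgK unitv)]_x (even_dist x)%:E)%E = n^-1%:E.
Proof.
rewrite integral_spectral_density; [|exact: measurable_even_dist|].
  rewrite sum_eigenvalues_cayley sum_cube_even_dist /= card_cube mulrA mulVf ?mul1r //.
by move=> x; case/andP: (even_dist_bound x).
Qed.

Lemma integral_folded :
  (\int[spectral_density (cayley sgK foldedv)]_x (even_dist x)%:E)%E
  = 0%:E.
Proof.
rewrite integral_spectral_density; [|exact: measurable_even_dist|].
  by rewrite sum_eigenvalues_cayley sum_folded_even_dist mulr0.
by move=> x; case/andP: (even_dist_bound x).
Qed.
End Densities.
End TestFunction.

(** * Reduction to a test between the two graphs *)

Section Indistinguishability.
Context {R : realType} {k m T : nat}.
Local Notation V := {ffun 'I_k.+1 -> bool}.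
Local Notation Omega := {ffun 'I_m -> V * {ffun 'I_T -> 'I_k.+1}}.
Local Notation n := (k.+1%:R : R).
Local Notation transcript := (m.-tuple (T.+1.-tuple nat)).

Definition labelled_transcript (sg : V -> V) (s : 'I_k.+1 -> V) (w : Omega) : transcript :=
  map_tuple (map_tuple (@nat_of_ord #|{: V}|)) (trajectories sg s w).

Context (eps : R) (A : algorithm R transcript (probability (measurableTypeR R) R)).

Lemma success_prob_cayley_le (sg : V -> V) (sgK : involutive sg) (s : 'I_k.+1 -> V)
    (E : transcript -> set (seed A)) :
  (forall tau x, (W1 (spectral_density (cayley sgK s)) (run x tau) <= eps%:E)%E ->
     E tau x) ->
  (success_prob A eps (cayley sgK s) <=
   (#|{: Omega}|%:R^-1 *
    \sum_w fine (inner_prob (seed_law A) (E (labelled_transcript sg s w))))%:E)%E.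
Proof.
move=> subE.
rewrite -(sum_walks_cayley sgK s (fun W => fine (inner_prob (seed_law A)
  (E (map_tuple (map_tuple (@nat_of_ord #|{: V}|)) W))))).
rewrite -sumEFin /success_prob; apply: lee_sum => W _.
rewrite EFinM fineK ?inner_prob_fin_num //; apply: lee_wpmul2l.
  by rewrite lee_fin walks_prob_cayley mulr_ge0 ?invr_ge0 ?sumr_ge0.
by apply: le_inner_prob => x /=; exact: subE.
Qed.

Context (gap : 2 * eps < n^-1).

Let expect (x : seed A) (tau : transcript) : \bar R :=
  (\int[run x tau]_y (even_dist (k := k) y)%:E)%E.

(** Success on either graph forces the integral of [even_dist] under the output to be within [eps]
    of 1 / n or of 0. These events involve the transcript and seed only, not the gauge, and exclude
    each other since 2 eps < 1 / n. *)
Let claims_cube tau : R :=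
  fine (inner_prob (seed_law A) [set x | (n^-1%:E <= expect x tau + eps%:E)%E]%classic).
Let claims_folded tau : R :=
  fine (inner_prob (seed_law A) [set x | (expect x tau <= eps%:E)%E]%classic).

Lemma success_cube_le (sg : V -> V) (sgK : involutive sg) :
  (success_prob A eps (cayley sgK unitv) <=
   (#|{: Omega}|%:R^-1 * \sum_w claims_cube (labelled_transcript sg unitv w))%:E)%E.
Proof.
apply: (success_prob_cayley_le (sgK := sgK) (E := fun tau =>
  [set x | (n^-1%:E <= expect x tau + eps%:E)%E]%classic)) => tau x le_eps /=.
have [+ _] := lipschitz_W1 (spectral_density (cayley sgK unitv)) (run x tau)
  (@measurable_even_dist R k) (@even_dist_bound R k) (@even_dist_lip R k).
by rewrite integral_cube => /le_trans; apply; rewrite leeD2l.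
Qed.

Lemma success_folded_le (sg : V -> V) (sgK : involutive sg) :
  (success_prob A eps (cayley sgK foldedv) <=
   (#|{: Omega}|%:R^-1 * \sum_w claims_folded (labelled_transcript sg foldedv w))%:E)%E.
Proof.
apply: (success_prob_cayley_le (sgK := sgK) (E := fun tau =>
  [set x | (expect x tau <= eps%:E)%E]%classic)) => tau x le_eps /=.
have [_] := lipschitz_W1 (spectral_density (cayley sgK foldedv)) (run x tau)
  (@measurable_even_dist R k) (@even_dist_bound R k) (@even_dist_lip R k).
by rewrite integral_folded add0e => /le_trans; apply.
Qed.

Lemma claims_cube_le1 tau : claims_cube tau <= 1.
Proof. by rewrite -lee_fin fineK ?inner_prob_fin_num // inner_prob_le1. Qed.

Lemma claims_folded_le1 tau : claims_folded tau <= 1.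
Proof. by rewrite -lee_fin fineK ?inner_prob_fin_num // inner_prob_le1. Qed.

Lemma claims_disjoint tau : claims_cube tau + claims_folded tau <= 1.
Proof.
rewrite -lee_fin EFinD !fineK ?inner_prob_fin_num //.
apply: inner_prob_disjoint; apply/seteqP; split => // x [/= le1 le2].
have := le_trans le1 (leeD2r eps%:E le2).
by rewrite -EFinD lee_fin leNgt -mulr2n -[eps *+ 2]mulr_natl gap.
Qed.

(** On a good outcome, reindexing by [d] gives both graphs the same transcripts, where the two
    exclusive claims total at most 1; on a bad one the trivial bound 2 is used. *)
Lemma sum_gauges (w : Omega) :
  \sum_(g : {ffun V -> bool}) (claims_cube (labelled_transcript (gauge g) unitv w) +
     claims_folded (labelled_transcript (gauge g) foldedv w)) <=
  #|{ffun V -> bool}|%:R * (1 + (bad w)%:R).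
Proof.
rewrite mulr_natl -sumr_const; have [bw|good] := boolP (bad w).
  by apply: ler_sum => g _; rewrite lerD ?claims_cube_le1 ?claims_folded_le1.
have [d dP] := gauge_good good.
rewrite big_split /=.
have -> : \sum_g claims_cube (labelled_transcript (gauge g) unitv w) =
    \sum_g claims_cube (labelled_transcript (gauge g) foldedv w).
  rewrite [RHS](reindex (fun g : {ffun V -> bool} => g + d)) /=; last first.
    by exists (fun g : {ffun V -> bool} => g - d) => g _; rewrite ?addrK ?subrK.
  apply: eq_bigr => g _; congr claims_cube; rewrite /labelled_transcript; congr map_tuple.
  apply: eq_from_tnth => j; rewrite !tnth_mktuple.
  by apply: eq_from_tnth => t; rewrite !tnth_mktuple /vlabel dP.
by rewrite -big_split /=; apply: ler_sum => g _; rewrite addr0 claims_disjoint.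
Qed.

Lemma no_uniform_success : 128 * (m * T)%:R ^+ 2 <= (2 ^ k.+1)%:R :> R ->
  (forall G : wgraph R, ((3 / 4)%:E < success_prob A eps G)%E) -> False.
Proof.
move=> mT_le succ.
pose N : R := #|{: Omega}|%:R; pose K : R := #|{ffun V -> bool}|%:R.
have N_gt0 : 0 < N.
  by rewrite ltr0n; apply/card_gt0P; exists [ffun=> (0, [ffun=> ord0])].
have K_gt0 : 0 < K by rewrite ltr0n; apply/card_gt0P; exists 0.
have low1 g : 3 / 4 * N <= \sum_w claims_cube (labelled_transcript (gauge g) unitv w).
  have := lt_le_trans (succ _) (success_cube_le (gaugeK g)).
  by rewrite lte_fin [ltRHS]mulrC ltr_pdivlMr // => /ltW.
have low2 g : 3 / 4 * N <= \sum_w claims_folded (labelled_transcript (gauge g) foldedv w).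
  have := lt_le_trans (succ _) (success_folded_le (gaugeK g)).
  by rewrite lte_fin [ltRHS]mulrC ltr_pdivlMr // => /ltW.
have low : K * (3 / 2 * N) <= \sum_w \sum_g
    (claims_cube (labelled_transcript (gauge g) unitv w) +
     claims_folded (labelled_transcript (gauge g) foldedv w)).
  rewrite exchange_big [leLHS]mulr_natl -sumr_const /=; apply: ler_sum => g _.
  by rewrite big_split /=; have := low1 g; have := low2 g; lra.
have upp : \sum_w \sum_g (claims_cube (labelled_transcript (gauge g) unitv w) +
     claims_folded (labelled_transcript (gauge g) foldedv w)) <=
    K * (N + \sum_(w : Omega) (bad w)%:R).
  apply: le_trans (ler_sum _ (fun w _ => sum_gauges w)) _.
  by rewrite -mulr_sumr big_split /= sumr_const.
have := le_trans low upp; rewrite ler_pM2l // => le_bad.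
have V_gt0 : 0 < (2 ^ k.+1)%:R :> R by rewrite ltr0n expn_gt0.
have := @sum_bad k m T R; rewrite -/N.
set S := \sum_w _ in le_bad *; set c := (m * T)%:R ^+ 2 in mT_le *.
set v := (2 ^ k.+1)%:R in mT_le V_gt0 * => le1.
have le2 : 128 * c * N <= v * N by rewrite ler_pM2r.
have le3 : v * (3 / 2 * N) <= v * (N + S) by rewrite ler_pM2l.
have vN : 0 < v * N by rewrite mulr_gt0.
(* [le_bad] forces S >= N / 2, while [le1] and [le2] give v S <= 8 c N <= v N / 16. *)
nra.
Qed.
End Indistinguishability.

(** * Choice of the dimension and conclusion *)

Lemma exists_dimension (R : realType) (eps : R) : 0 < eps -> eps < 1 / 2 ->
  exists k : nat, 2 * eps < k.+1%:R^-1 /\ 1 / (2 * eps) <= k.+2%:R.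
Proof.
move=> e0 e2.
have ex : exists k : nat, 1 / (2 * eps) <= k.+2%:R.
  exists (Num.truncn (1 / (2 * eps))).
  by rewrite (le_trans (ltW (truncnS_gt _))) // ler_nat.
case: (ex_minnP ex) => k kP kmin; exists k; split => //.
have e2_gt0 : 0 < 2 * eps by rewrite mulr_gt0.
(* This follows from the minimality of [k], and for [k = 0] from eps < 1 / 2. *)
suff lt : k.+1%:R < 1 / (2 * eps).
  by rewrite -[2 * eps]invrK ltf_pV2 ?posrE ?invr_gt0 ?ltr0n // -[_^-1]mul1r.
case: k kP kmin => [|k] kP kmin.
  by rewrite ltr_pdivlMr // mul1r; lra.
rewrite ltNge; apply/negP => /kmin; by rewrite ltnn.
Qed.

Theorem theorem3 (R : realType) (eps : R) (m T : nat)
    (eps_gt0 : 0 < eps) (eps_lt : eps < 1 / 2)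
    (mT_le : (m * T)%:R <= 1 / 16 * 2 `^ (1 / (4 * eps))) :
  ~ exists A : algorithm R (m.-tuple (T.+1.-tuple nat))
                 (probability (measurableTypeR R) R),
      forall G : wgraph R, ((3 / 4)%:E < success_prob A eps G)%E.
Proof.
case=> A; have [k [gap dim]] := exists_dimension eps_gt0 eps_lt.
apply: (no_uniform_success gap); rewrite natrX.
(* With P = 2^(1 / (4 eps)), this reads P^2 <= 2^(k + 2), so m T <= P / 16 gives 128 (m T)^2 <= P^2
   / 2 <= 2^(k + 1). *)
have : 2 `^ (1 / (2 * eps)) <= 2 ^+ k.+2 :> R.
  by rewrite -powR_mulrn // ler_powR // ler1n.
have -> : 1 / (2 * eps) = 1 / (4 * eps) + 1 / (4 * eps) by field; rewrite gt_eqF.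
rewrite powRD ?pnatr_eq0 ?implybT // exprS.
have := powR_ge0 2 (1 / (4 * eps)) : 0 <= 2 `^ (1 / (4 * eps)) :> R.
move: mT_le; set P := 2 `^ _; set x := (m * T)%:R; have : 0 <= x by [].
set y := 2 ^+ k.+1; nra.
Qed.
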